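(* Fix $L>0$ and initial data $(\rho_0,u_0,p_0,a_0,b_0,q_0)\in\mathbb R^6$ with $\rho_0>0$, $u_0\ne0$, and let $(\rho,u,p,k_1,k_2,q)$ be the unique local real-analytic solution near $s=0$ of $$\begin{aligned}\rho'&=q\rho,\\ u'&=p,\\ p'&=-qp-\Bigl(k_1^2+k_2^2-\tfrac{2}{L^2}\Bigr)u,\\ k_2'&=q(k_1-k_2),\\ k_1'&=-2k_1\tfrac{p}{u}-q(k_1-k_2),\\ q'&=\tfrac1{L^2}+k_1k_2-q^2\end{aligned}$$ with $\rho(0)=\rho_0$, $u(0)=u_0$, $p(0)=p_0$, $k_1(0)=a_0$, $k_2(0)=b_0$, $q(0)=q_0$. Put $H=-\frac{k_1+k_2}{2}$, $H_0=-\frac{a_0+b_0}{2}$, and assume $$H_0\neq0,\qquad \frac{u_0}{H_0}>0,\qquad a_0p_0\neq0,\qquad p_0(H_0-a_0)\neq0.$$ Let $\lambda>0$ be defined near $s=0$ by $\lambda^2=u/H$. (These data determine, near $s=0$, a proper biharmonic conformal spacelike immersion into $\mathrm{AdS}_3(L)$ with mean curvature $H$ and conformal dilation $\lambda$, as described in the context.) Then both the mean curvature $H$ and the conformal dilation $\lambda$ are nonconstant on every sufficiently small neighbourhood of $s=0$. Moreover, the four displayed conditions define an open subset of the initial-data space $\{(\rho_0,u_0,p_0,a_0,b_0,q_0)\in\mathbb R^6:\rho_0>0,\ u_0\neq0\}$.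
   Context: Geometric meaning of the data: under the first two conditions the solution determines, for $\delta$ small and $J\subset\mathbb R$ an interval, a spacelike immersion $\phi:(-\delta,\delta)\times J\to\mathrm{AdS}_3(L)$ (unique locally up to ambient isometry) with induced metric $g=ds^2+\rho(s)^2dt^2$, timelike unit normal $\xi$, and shape operator $A\partial_s=k_1\partial_s$, $A\partial_t=k_2\partial_t$, where $\nabla^N_X\xi=-AX$; its scalar mean curvature (mean-curvature vector $=H\xi$) is $H=-\frac12\operatorname{tr}_gA=-\frac{k_1+k_2}{2}$, and $\phi:((-\delta,\delta)\times J,\lambda^{-2}g)\to\mathrm{AdS}_3(L)$ with $\lambda^2=u/H$ is biharmonic and not harmonic. Here $\mathrm{AdS}_3(L)$ is the Lorentzian hyperquadric $\{\langle X,X\rangle=-L^2\}\subset\mathbb R^{2,2}$ with $\langle X,X\rangle=-X_0^2-X_1^2+X_2^2+X_3^2$, of constant sectional curvature $-1/L^2$. Biharmonic means that the bitension field of the map (the Euler-Lagrange field of $\frac12\int|\tau|^2$) vanishes. Primes denote $d/ds$. *)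

(* Defs.v *)
From Stdlib Require Import Reals.
From Coquelicot Require Import Coquelicot.
Open Scope R_scope.

Definition real_analytic_at (f : R -> R) (x : R) : Prop :=
  exists a : nat -> R, locally x (fun y => is_pseries a (y - x) (f y)).

(* The functions are total on R, but only their germs at 0 are constrained:
   [locally 0] means "on some interval around 0". *)
Record local_analytic_solution (L rho0 u0 p0 a0 b0 q0 : R)
    (rho u p k1 k2 q : R -> R) : Prop := {
  sol_analytic :
    real_analytic_at rho 0 /\ real_analytic_at u 0 /\ real_analytic_at p 0 /\
    real_analytic_at k1 0 /\ real_analytic_at k2 0 /\ real_analytic_at q 0;
  sol_rho : locally 0 (fun s => is_derive rho s (q s * rho s));
  sol_u : locally 0 (fun s => is_derive u s (p s));
  sol_p : locally 0 (fun s => is_derive p s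
    (- q s * p s - (k1 s ^ 2 + k2 s ^ 2 - 2 / L ^ 2) * u s));
  sol_k2 : locally 0 (fun s => is_derive k2 s (q s * (k1 s - k2 s)));
  sol_k1 : locally 0 (fun s => is_derive k1 s
    (- 2 * k1 s * (p s / u s) - q s * (k1 s - k2 s)));
  sol_q : locally 0 (fun s => is_derive q s
    (1 / L ^ 2 + k1 s * k2 s - q s ^ 2));
  sol_init :
    rho 0 = rho0 /\ u 0 = u0 /\ p 0 = p0 /\ k1 0 = a0 /\ k2 0 = b0 /\ q 0 = q0
}.

(* Scalar mean curvature -(1/2) tr A of a surface whose shape operator A has
   eigenvalues k1, k2; the mean curvature vector is this scalar times the
   timelike unit normal. *)
Definition mean_curvature (k1 k2 : R) : R := - ((k1 + k2) / 2).

Definition nonconstant_near (f : R -> R) (x : R) : Prop :=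
  exists eps : posreal, forall U : R -> Prop,
    locally x U -> (forall s, U s -> ball x eps s) ->
    exists s1 s2, U s1 /\ U s2 /\ f s1 <> f s2.

Definition open_in {T : UniformSpace} (D S : T -> Prop) : Prop :=
  (forall x, S x -> D x) /\
  exists V : T -> Prop, open V /\ forall x, S x <-> D x /\ V x.

(* Coordinates are (rho0, u0, p0, a0, b0, q0). *)
Definition initial_data : Type := (R * R * R * R * R * R)%type.

Definition initial_data_space (x : initial_data) : Prop :=
  let '(rho0, u0, p0, a0, b0, q0) := x in 0 < rho0 /\ u0 <> 0.

Definition nondegenerate (x : initial_data) : Prop :=
  let '(rho0, u0, p0, a0, b0, q0) := x in
  let H0 := mean_curvature a0 b0 in
  H0 <> 0 /\ u0 / H0 > 0 /\ a0 * p0 <> 0 /\ p0 * (H0 - a0) <> 0.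

(* Main.v *)
Require Import Defs.
From Stdlib Require Import Reals Lra Classical.
From Coquelicot Require Import Coquelicot.
Open Scope R_scope.

(** Both nonconstancy claims are first-order: a function with nonzero derivative
    at a point is nonconstant near it. Adding the equations for [k1] and [k2]
    cancels the terms [q (k1 - k2)], which leaves [H' = k1 p / u]; with
    [u' = p] the quotient rule then gives [(u / H)' = p (H - k1) / H^2]. At
    [s = 0] the numerators are [a0 p0] and [p0 (H0 - a0)], nonzero by
    hypothesis. This settles [H] directly ([mean_curvature_derive]), and
    [lambda] because a function whose square is nonconstant is itself
    nonconstant ([dilation_sqr_derive], [nonconstant_near_of_comp]).

    For the openness, [u0 / H0 > 0] is equivalent to the polynomial condition
    [u0 H0 > 0], which also contains [H0 <> 0]; the nondegenerate set is thus
    cut out by polynomial conditions of the form [<> 0] and [> 0]. *)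

(** If [f] were constant on some neighbourhood of [x], of whatever size, its
    derivative at [x] would vanish. The radius [1] chosen for [eps] is therefore
    arbitrary. *)
Lemma nonconstant_near_of_derive (f : R -> R) (x l : R) :
  is_derive f x l -> l <> 0 -> nonconstant_near f x.
Proof.
  intros Hf Hl. exists (mkposreal 1 Rlt_0_1). intros U HU _.
  apply NNPP. intros Hn. apply Hl.
  assert (Hc : is_derive (fun _ : R => f x) x l).
  { apply is_derive_ext_loc with f; [ | exact Hf].
    apply filter_imp with (2 := HU). intros y Hy.
    apply NNPP. intros Hne. apply Hn.
    exists y, x. repeat split; trivial. now apply locally_singleton. }
  rewrite <- (is_derive_unique _ _ _ Hc). apply Derive_const.
Qed.

Lemma nonconstant_near_of_comp (g f : R -> R) (x : R) :
  nonconstant_near (fun s => g (f s)) x -> nonconstant_near f x.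
Proof.
  intros [eps Heps]. exists eps. intros U HU Hsub.
  destruct (Heps U HU Hsub) as (s1 & s2 & H1 & H2 & Hne).
  exists s1, s2. repeat split; trivial. intros E. apply Hne. now rewrite E.
Qed.

Section DerivativesAtZero.

Context {L rho0 u0 p0 a0 b0 q0 : R} {rho u p k1 k2 q : R -> R}.
Context (sol : local_analytic_solution L rho0 u0 p0 a0 b0 q0 rho u p k1 k2 q).
Context (u0_neq0 : u0 <> 0).

Lemma mean_curvature_derive :
  is_derive (fun s => mean_curvature (k1 s) (k2 s)) 0 (a0 * p0 / u0).
Proof.
  destruct sol as [_ _ _ _ D2 D1 _ (_ & Eu & Ep & E1 & _)].
  apply locally_singleton in D1, D2.
  unfold mean_curvature. auto_derive.
  - split; [now eexists; exact D1 | split; [now eexists; exact D2 | exact I]].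
  - rewrite (is_derive_unique (fun s : R => k1 s) 0 _ D1),
      (is_derive_unique (fun s : R => k2 s) 0 _ D2),
      Eu, Ep, E1.
    now field.
Qed.

Lemma dilation_sqr_derive (lambda : R -> R) :
  mean_curvature a0 b0 <> 0 ->
  locally 0 (fun s => lambda s ^ 2 = u s / mean_curvature (k1 s) (k2 s)) ->
  is_derive (fun s => lambda s ^ 2) 0
    (p0 * (mean_curvature a0 b0 - a0) / mean_curvature a0 b0 ^ 2).
Proof.
  intros H0_neq0 Hlam.
  destruct sol as [_ _ Du _ _ _ _ (_ & Eu & Ep & E1 & E2 & _)].
  apply locally_singleton in Du.
  apply is_derive_ext_loc with (fun s => u s / mean_curvature (k1 s) (k2 s)).
  { apply filter_imp with (2 := Hlam). now intros s ->. }
  (* the shape in which the quotient rule delivers the derivative *)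
  replace (p0 * (mean_curvature a0 b0 - a0) / mean_curvature a0 b0 ^ 2)
    with ((p 0 * mean_curvature (k1 0) (k2 0) - u 0 * (a0 * p0 / u0))
          / mean_curvature (k1 0) (k2 0) ^ 2)
    by (rewrite Eu, Ep, E1, E2; field; auto).
  apply (is_derive_div u (fun s => mean_curvature (k1 s) (k2 s)));
    [exact Du | exact mean_curvature_derive | ].
  now rewrite E1, E2.
Qed.

End DerivativesAtZero.

Lemma open_continuous_neq0 {T : UniformSpace} (f : T -> R) :
  (forall x, continuous f x) -> open (fun x => f x <> 0).
Proof.
  intros Hf. apply (open_comp f (fun y => y <> 0)).
  - intros x _. apply Hf.
  - apply open_neq.
Qed.

Lemma open_continuous_gt0 {T : UniformSpace} (f : T -> R) :
  (forall x, continuous f x) -> open (fun x => 0 < f x).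
Proof.
  intros Hf. apply (open_comp f (fun y => 0 < y)).
  - intros x _. apply Hf.
  - apply open_gt.
Qed.

Lemma continuous_mean_curvature {T : UniformSpace} (f g : T -> R) (x : T) :
  continuous f x -> continuous g x ->
  continuous (fun y => mean_curvature (f y) (g y)) x.
Proof.
  intros Hf Hg. apply (continuous_opp (fun y => (f y + g y) / 2)).
  apply (continuous_mult (fun y => f y + g y) (fun _ => / 2)).
  - now apply (continuous_plus f g).
  - apply continuous_const.
Qed.

(** Multiplying [u / H] by [H^2 > 0] removes the division, and positivity of
    the product already forces [H <> 0]. *)
Lemma div_gt0_iff_mult_gt0 (u H : R) : (H <> 0 /\ u / H > 0) <-> 0 < u * H.
Proof.
  split.
  - intros [HH Hd]. replace (u * H) with (u / H * H ^ 2) by now field.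
    apply Rmult_lt_0_compat; [exact Hd | now apply pow2_gt_0].
  - intros Hm.
    assert (HH : H <> 0) by (intros ->; lra).
    split; [exact HH | ].
    replace (u / H) with (u * H / H ^ 2) by now field.
    apply Rdiv_lt_0_compat; [exact Hm | now apply pow2_gt_0].
Qed.

Lemma continuous_fst_comp {T U V : UniformSpace} (f : T -> U * V) (x : T) :
  continuous f x -> continuous (fun y => fst (f y)) x.
Proof.
  intros Hf. apply (continuous_comp f fst); [exact Hf | ].
  destruct (f x). apply continuous_fst.
Qed.

Lemma continuous_snd_comp {T U V : UniformSpace} (f : T -> U * V) (x : T) :
  continuous f x -> continuous (fun y => snd (f y)) x.
Proof.
  intros Hf. apply (continuous_comp f snd); [exact Hf | ].
  destruct (f x). apply continuous_snd.
Qed.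

Lemma open_nondegenerate :
  open_in initial_data_space
    (fun x : initial_data => initial_data_space x /\ nondegenerate x).
Proof.
  split; [tauto | ].
  pose (fu := fun x : initial_data => snd (fst (fst (fst (fst x))))).
  pose (fp := fun x : initial_data => snd (fst (fst (fst x)))).
  pose (fa := fun x : initial_data => snd (fst (fst x))).
  pose (fb := fun x : initial_data => snd (fst x)).
  assert (Cu : forall x, continuous fu x).
  { intros x. now repeat (apply continuous_fst_comp || apply continuous_snd_comp);
      apply continuous_id. }
  assert (Cp : forall x, continuous fp x).
  { intros x. now repeat (apply continuous_fst_comp || apply continuous_snd_comp);
      apply continuous_id. }
  assert (Ca : forall x, continuous fa x).
  { intros x. now repeat (apply continuous_fst_comp || apply continuous_snd_comp);
      apply continuous_id. }
  assert (Cb : forall x, continuous fb x).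
  { intros x. now repeat (apply continuous_fst_comp || apply continuous_snd_comp);
      apply continuous_id. }
  pose (fH := fun x => mean_curvature (fa x) (fb x)).
  assert (CH : forall x, continuous fH x).
  { intros x. now apply continuous_mean_curvature. }
  exists (fun x => 0 < fu x * fH x /\ fa x * fp x <> 0
                   /\ fp x * (fH x - fa x) <> 0).
  split.
  - repeat apply open_and.
    + apply open_continuous_gt0. intros x. now apply (continuous_mult fu fH).
    + apply open_continuous_neq0. intros x. now apply (continuous_mult fa fp).
    + apply open_continuous_neq0. intros x.
      apply (continuous_mult fp (fun y => fH y - fa y)); [easy | ].
      now apply (continuous_minus fH fa).
  - intros [[[[[r v] w] a] b] c]. unfold nondegenerate, fu, fp, fH, fa, fb; simpl.
    pose proof (div_gt0_iff_mult_gt0 v (mean_curvature a b)). tauto.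
Qed.

Theorem corollary4p2 (L : R) (hL : 0 < L) :
  (forall rho0 u0 p0 a0 b0 q0 : R,
     initial_data_space (rho0, u0, p0, a0, b0, q0) ->
   forall rho u p k1 k2 q : R -> R,
     local_analytic_solution L rho0 u0 p0 a0 b0 q0 rho u p k1 k2 q ->
     nondegenerate (rho0, u0, p0, a0, b0, q0) ->
   let H := fun s => mean_curvature (k1 s) (k2 s) in
   forall lambda : R -> R,
     locally 0 (fun s => 0 < lambda s /\ lambda s ^ 2 = u s / H s) ->
     nonconstant_near H 0 /\ nonconstant_near lambda 0) /\
  open_in initial_data_space
    (fun x : initial_data => initial_data_space x /\ nondegenerate x).
Proof.
  split; [ | exact open_nondegenerate].
  intros rho0 u0 p0 a0 b0 q0 [_ Hu] rho u p k1 k2 q sol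
    (HH & _ & Hap & Hpa) H lambda Hlam.
  split.
  - apply nonconstant_near_of_derive with (1 := mean_curvature_derive sol Hu).
    apply Rmult_integral_contrapositive_currified;
      [exact Hap | now apply Rinv_neq_0_compat].
  - apply (nonconstant_near_of_comp (fun y => y ^ 2)).
    apply nonconstant_near_of_derive
      with (p0 * (mean_curvature a0 b0 - a0) / mean_curvature a0 b0 ^ 2).
    + apply (dilation_sqr_derive sol Hu); [exact HH | ].
      apply filter_imp with (2 := Hlam). now intros s [_ E].
    + apply Rmult_integral_contrapositive_currified; [exact Hpa | ].
      now apply Rinv_neq_0_compat, pow_nonzero.
Qed.
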